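(* Let $\varepsilon>0$, let $\xi^1,\xi^2\in\{1,-1\}^N$ with $\xi^1\neq\pm\xi^2$, let $C_{ij}=\xi^1_i\xi^1_j+\xi^2_i\xi^2_j$, and let $\eta\in\{1,-1\}^N\setminus\{\pm\xi^1,\pm\xi^2\}$. Let $\mathcal J_\eta$ be the $N\times N$ matrix with off-diagonal entries $(\mathcal J_\eta)_{ij}=\frac1N C_{ij}\eta_i\eta_j+\frac{2\varepsilon}{N}$ ($i\ne j$) and diagonal entries $(\mathcal J_\eta)_{ii}=-\frac1N\sum_{j\neq i}C_{ij}\eta_i\eta_j-\frac{2\varepsilon(N-1)}{N}$. With the index sets $I_1,I_2,I_{ab},I_{ab}^{\pm}$ ($a,b\in\{1,2\}$) and the subspaces $V[\mathbb 1],V(\cdot),V(\cdot\,;\cdot)$ defined in the context, for $\mathcal J_\eta$ we have: (1) $0$ is a single eigenvalue with eigenspace $V[\mathbb 1]$; (2) $-2\varepsilon$ is a single eigenvalue with eigenspace $V(I_1;I_2)$; (3) if $I_{11}\neq\emptyset$, then $2\big(\frac{-|I_{11}|+|I_{12}|}{N}-\varepsilon\big)$ is an eigenvalue with multiplicity $|I_{11}|-1$, corresponding to the eigenspace $V(I_{11}^+;I_{11}^-)+V(I_{11}^+)+V(I_{11}^-)$; (4) if $I_{12}\neq\emptyset$, then $2\big(\frac{|I_{11}|-|I_{12}|}{N}-\varepsilon\big)$ is an eigenvalue with multiplicity $|I_{12}|-1$, corresponding to the eigenspace $V(I_{12}^+;I_{12}^-)+V(I_{12}^+)+V(I_{12}^-)$;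 (5) if $I_{11}\neq\emptyset$ and $I_{12}\neq\emptyset$, then $2\big(\frac{|I_1|}{N}-\varepsilon\big)$ is a single eigenvalue with eigenspace $V(I_{11};I_{12})$; (6) if $I_{21}\neq\emptyset$, then $2\big(\frac{|I_{22}|-|I_{21}|}{N}-\varepsilon\big)$ is an eigenvalue with multiplicity $|I_{21}|-1$, corresponding to the eigenspace $V(I_{21}^+;I_{21}^-)+V(I_{21}^+)+V(I_{21}^-)$; (7) if $I_{22}\neq\emptyset$, then $2\big(\frac{-|I_{22}|+|I_{21}|}{N}-\varepsilon\big)$ is an eigenvalue with multiplicity $|I_{22}|-1$, corresponding to the eigenspace $V(I_{22}^+;I_{22}^-)+V(I_{22}^+)+V(I_{22}^-)$; (8) if $I_{21}\neq\emptyset$ and $I_{22}\neq\emptyset$, then $2\big(\frac{|I_2|}{N}-\varepsilon\big)$ is a single eigenvalue with eigenspace $V(I_{21};I_{22})$.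
   Context: $\mathcal J_\eta$ is the Jacobian, at the bipolar equilibrium $\varphi^*(\eta)$ (phases $\varphi_i,\varphi_j$ equal mod $2\pi$ if $\eta_i=\eta_j$, differing by $\pi$ mod $2\pi$ if $\eta_i\neq\eta_j$), of the system $\dot\varphi_i=\frac1N\sum_{j=1}^N C_{ij}\sin(\varphi_j-\varphi_i)+\frac{\varepsilon}{N}\sum_{j=1}^N\sin2(\varphi_j-\varphi_i)$, $i=1,\dots,N$, with memories $\xi^1,\xi^2$. Index sets (subsets of $\{1,\dots,N\}$): $I_1=\{j:\xi^1_j=\xi^2_j\}$, $I_2=\{j:\xi^1_j\ne\xi^2_j\}$, and for each sign $s\in\{+1,-1\}$ (written as superscript $\pm$): $I_{11}^{s}=\{j\in I_1:\xi^1_j=\xi^2_j=\eta_j=s\}$, $I_{12}^{s}=\{j\in I_1:\xi^1_j=\xi^2_j=-\eta_j=s\}$, $I_{21}^{s}=\{j\in I_2:\xi^1_j=-\xi^2_j=\eta_j=s\}$, $I_{22}^{s}=\{j\in I_2:\xi^1_j=-\xi^2_j=-\eta_j=s\}$; and $I_{ab}=I_{ab}^+\cup I_{ab}^-$. Subspaces of $\mathbb R^N$: $V[\mathbb 1]=\{k(1,\dots,1)^{\mathrm T}: k\in\mathbb R\}$. For $I\subset\{1,\dots,N\}$, $V(I)=\{x\in\mathbb R^N : x_i=0 \text{ for } i\notin I,\ \sum_{i\in I}x_i=0\}$. For disjoint $I,\hat I\subset\{1,\dots,N\}$, $V(I;\hat I)=\{k x^\star : k\in\mathbb R\}$ with $x^\star_i=|\hat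 I|$ for $i\in I$, $x^\star_i=-|I|$ for $i\in\hat I$, $x^\star_i=0$ otherwise; if $I$ or $\hat I$ is empty, $V(I;\hat I)=\{0\}$. For subspaces $V_1,V_2$, $V_1+V_2=\{y+z: y\in V_1, z\in V_2\}$. ''Single'' eigenvalue means an eigenvalue of multiplicity one.
   Formalization: The listed eigenvalues can coincide (e.g. ε=|I_1|/N); ''single'', the multiplicity and ''eigenspace'' are claimed when no other listed family of positive multiplicity shares the value; otherwise the listed spaces and multiplicities add up. Multiplicity 0 means no eigenvalue is claimed. *)

(* Defs.v *)
From HB Require Import structures.
From mathcomp Require Import all_boot all_order all_algebra.
Set Implicit Arguments. Unset Strict Implicit. Unset Printing Implicit Defensive.
Import Order.TTheory GRing.Theory Num.Theory.
Import passmx.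
Local Open Scope ring_scope.

Section Defs.
Variables (R : realFieldType) (N : nat).
Implicit Types (x xi eta : 'cV[R]_N) (s lam : R) (I J : {set 'I_N}).

Definition sign_vector x : Prop := forall i, x i 0 = 1 \/ x i 0 = -1.

Definition coupling xi1 xi2 : 'M[R]_N :=
  \matrix_(i, j) (xi1 i 0 * xi1 j 0 + xi2 i 0 * xi2 j 0).

Definition jacobian (eps : R) (C : 'M[R]_N) eta : 'M[R]_N :=
  \matrix_(i, j)
    if i == j then
      - (N%:R^-1 * \sum_(k < N | k != i) C i k * eta i 0 * eta k 0)
      - 2 * eps * (N%:R - 1) / N%:R
    else N%:R^-1 * C i j * eta i 0 * eta j 0 + 2 * eps / N%:R.

Definition I1 xi1 xi2 : {set 'I_N} := [set j | xi1 j 0 == xi2 j 0].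
Definition I2 xi1 xi2 : {set 'I_N} := [set j | xi1 j 0 != xi2 j 0].

(* The superscript sign is the scalar s, used at s = 1 and s = -1. *)
Definition I11s xi1 xi2 eta s : {set 'I_N} :=
  [set j in I1 xi1 xi2 | [&& xi1 j 0 == s, xi2 j 0 == s & eta j 0 == s]].
Definition I12s xi1 xi2 eta s : {set 'I_N} :=
  [set j in I1 xi1 xi2 | [&& xi1 j 0 == s, xi2 j 0 == s & - eta j 0 == s]].
Definition I21s xi1 xi2 eta s : {set 'I_N} :=
  [set j in I2 xi1 xi2 | [&& xi1 j 0 == s, - xi2 j 0 == s & eta j 0 == s]].
Definition I22s xi1 xi2 eta s : {set 'I_N} :=
  [set j in I2 xi1 xi2 | [&& xi1 j 0 == s, - xi2 j 0 == s & - eta j 0 == s]].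

Definition Vone : {vspace 'cV[R]_N} := <[const_mx 1%R]>%VS.

Definition Vsum0 I : {vspace 'cV[R]_N} :=
  (lker (linfun (fun x => (\sum_(i in I) x i 0)%R : R^o))
   :&: \bigcap_(i | i \notin I) lker (linfun (fun x => x i 0%R : R^o)))%VS.

Definition xstar I J : 'cV[R]_N :=
  \col_i (if i \in I then #|J|%:R else if i \in J then - #|I|%:R else 0).

Definition Vpair I J : {vspace 'cV[R]_N} :=
  if (I == set0) || (J == set0) then 0%VS else <[xstar I J]>%VS.

Definition mxend (A : 'M[R]_N) : 'End('cV[R]_N) := linfun (mulmx A).

Definition eigsp (A : 'M[R]_N) lam : {vspace 'cV[R]_N} :=
  leigenspace (mxend A) lam.

Definition Ipm (K : R -> {set 'I_N}) : {set 'I_N} := K 1 :|: K (-1).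

Definition Vpm (K : R -> {set 'I_N}) : {vspace 'cV[R]_N} :=
  (Vpair (K 1) (K (-1)) + Vsum0 (K 1) + Vsum0 (K (-1)))%VS.

(* (eigenvalue, multiplicity, eigenspace) *)
Notation eigenfamily := (R * nat * {vspace 'cV[R]_N})%type.
Definition value (f : eigenfamily) : R := f.1.1.
Definition multiplicity (f : eigenfamily) : nat := f.1.2.
Definition space (f : eigenfamily) : {vspace 'cV[R]_N} := f.2.

(* The values of two families may coincide: eps = |I_1|/N makes the value of
   V(I_11; I_12) equal to 0, and |I_11| = |I_12| makes that of I_11 equal to
   -2 eps.  The multiplicities then add up, so the equality of the eigenspace
   with the listed space, and of the algebraic multiplicity with the listed one,
   is claimed when no other family of F with positive multiplicity has the same
   value. *)
Definition eigenvalue_as_listed (A : 'M[R]_N) (F : seq eigenfamily)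
    (f : eigenfamily) : Prop :=
  [/\ (space f <= eigsp A (value f))%VS,
      \dim (space f) = multiplicity f,
      (0 < multiplicity f)%N -> leigenvalue (mxend A) (value f) &
      (forall g : eigenfamily, g \in F -> (0 < multiplicity g)%N ->
         value g = value f -> g = f) ->
      eigsp A (value f) = space f /\
      mup (value f) (char_poly A) = multiplicity f].

(* The first two clauses say that R^N is the direct sum of the listed spaces. *)
Definition spectrum_exhausted_by (A : 'M[R]_N) (F : seq eigenfamily) : Prop :=
  [/\ (\sum_(f <- F) space f)%VS = fullv,
      (\sum_(f <- F) \dim (space f))%N = N,
      char_poly A = \prod_(f <- F) ('X - (value f)%:P) ^+ multiplicity f &
      forall a, eigsp A a = (\sum_(f <- F | value f == a) space f)%VS].

Lemma mem_Vsum0 I x :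
  reflect ((forall i, i \notin I -> x i 0 = 0) /\ \sum_(i in I) x i 0 = 0)
          (x \in Vsum0 I).
Proof.
have coordE i : linfun (fun y : 'cV[R]_N => y i 0 : R^o) x = x i 0.
  pose f (y : 'cV[R]_N) : R^o := y i 0.
  have lf : linear f by move=> a u v; rewrite /f !mxE.
  pose fL := GRing.isLinear.Build _ _ _ _ f lf.
  exact: (lfunE (HB.pack_for {linear 'cV[R]_N -> R^o} f fL)).
have sumE : linfun (fun y : 'cV[R]_N => \sum_(i in I) y i 0 : R^o) x
            = \sum_(i in I) x i 0.
  pose f (y : 'cV[R]_N) : R^o := \sum_(i in I) y i 0.
  have lf : linear f.
    move=> a u v; rewrite /f scaler_sumr -big_split /=.
    by apply: eq_bigr => i _; rewrite !mxE.
  pose fL := GRing.isLinear.Build _ _ _ _ f lf.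
  exact: (lfunE (HB.pack_for {linear 'cV[R]_N -> R^o} f fL)).
rewrite memv_cap memv_ker sumE.
apply: (iffP andP) => [[/eqP -> /subv_bigcapP h]|[h ->]]; split=> //.
  by move=> i /h; rewrite -memvE memv_ker coordE => /eqP.
by apply/subv_bigcapP => i /h xi0; rewrite -memvE memv_ker coordE xi0.
Qed.

Lemma mem_eigsp (A : 'M[R]_N) lam x : (x \in eigsp A lam) = (A *m x == lam *: x).
Proof.
by rewrite /eigsp /leigenspace memv_ker !lfun_simp subr_eq0.
Qed.

End Defs.

(* Main.v *)
(** Write [a k = xi1 k * eta k] and [b k = xi2 k * eta k].  Then [N (J x)_i] equals
    [a_i <a, x> + b_i <b, x> + 2 eps <1, x>
     - (a_i <a, 1> + b_i <b, 1> + 2 eps N) x_i],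
    and [I_11], [I_12], [I_21], [I_22] are the level sets of [(a, b)] at
    [(1, 1)], [(-1, -1)], [(1, -1)], [(-1, 1)].  On a zero-sum vector supported in
    one level set the inner products vanish and [J] is a scalar; the remaining
    listed vectors are checked directly.
    For disjoint sets, zero-sum vectors split as
    [V(I u K) = V(I; K) + V(I) + V(K)]; this gives
    [V(K+; K-) + V(K+) + V(K-) = V(K+ u K-)] and, iterated, shows that the listed
    spaces span [R^N].  Their dimensions are at most the listed multiplicities,
    which add up to [N], so the sum is direct and the spectrum can be read off. *)
Require Import Defs.
From mathcomp Require Import all_boot all_order all_algebra.
From mathcomp Require Import zify ring.
Set Implicit Arguments. Unset Strict Implicit. Unset Printing Implicit Defensive.
Import Order.TTheory GRing.Theory Num.Theory.
Local Open Scope ring_scope.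

(** * Characteristic polynomials of diagonalisable matrices *)

(** Placing the eigenvectors in the columns of [P] gives [A P = P D] with [D] diagonal. As [n]
    vectors that span, they make [P] invertible, so [A] is similar to [D]. *)
Lemma char_poly_eigenbasis (R : fieldType) (n : nat) (A : 'M[R]_n)
    (E : seq (R * 'cV[R]_n)) :
  size E = n -> <<unzip2 E>>%VS = fullv ->
  {in E, forall e, A *m e.2 = e.1 *: e.2} ->
  char_poly A = \prod_(e <- E) ('X - e.1%:P).
Proof.
move=> sizeE spanE AE.
pose e (i : 'I_n) := nth (0, 0) E i.
have eE i : e i \in E by rewrite mem_nth // sizeE.
pose P : 'M[R]_n := \matrix_(i, j) (e j).2 i 0.
pose d : 'rV[R]_n := \row_j (e j).1.
have col_P j : col j P = (e j).2 by apply/colP=> i; rewrite !mxE.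
have AP : A *m P = P *m diag_mx d.
  apply/matrixP=> i j; rewrite mul_mx_diag !mxE mulrC.
  have /colP/(_ i) := AE _ (eE j); rewrite !mxE => <-.
  by apply: eq_bigr => k _; rewrite mxE.
have Pu : P \in unitmx.
  rewrite -row_free_unit; apply: inj_row_free => v vP0.
  (* [v] annihilates every column of [P], hence their span, which is the whole space; the unit
     vectors then give [v = 0]. *)
  have vw (w : 'cV[R]_n) : v *m w = 0.
    have : w \in <<in_tuple (unzip2 E)>>%VS by rewrite spanE memvf.
    move/coord_span=> ->; rewrite mulmx_sumr big1 // => i _.
    have ltiE : (i < n)%N by case: i => i /=; rewrite size_map sizeE.
    rewrite -scalemxAr /= (nth_map (0, 0)) ?sizeE //.
    rewrite -[nth _ _ _]/(e (Ordinal ltiE)) -col_P colE.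
    by rewrite mulmxA vP0 mul0mx scaler0.
  apply/rowP=> j; have := vw (delta_mx j 0).
  by rewrite -colE => /colP/(_ 0); rewrite !mxE.
have -> : char_poly A = char_poly (diag_mx d).
  pose Q : 'M[{poly R}]_n := map_mx polyC P.
  have Q0 : \det Q != 0.
    rewrite det_map_mx polyC_eq0; move: Pu; rewrite unitmxE.
    by rewrite unitfE.
  (* Over the polynomials, [(X - A) Q = Q (X - D)]; in the determinants the nonzero factor [\det Q]
     cancels. *)
  apply: (mulIf Q0); rewrite /char_poly -det_mulmx [RHS]mulrC -det_mulmx.
  congr (\det _); rewrite /char_poly_mx mulmxBl mulmxBr -!map_mxM AP.
  by rewrite scalar_mxC.
rewrite char_poly_trig ?diag_mx_is_trig // (big_nth (0, 0)) big_mkord sizeE.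
by apply: eq_bigr => i _; rewrite !mxE eqxx mulr1n.
Qed.

Lemma mup_prod_XsubC (R : fieldType) (T : eqType) (s : seq T) (v : T -> R)
    (m : T -> nat) a :
  mup a (\prod_(f <- s) ('X - (v f)%:P) ^+ m f)
  = (\sum_(f <- s | v f == a) m f)%N.
Proof.
have nz f : ('X - (v f)%:P) ^+ m f != 0.
  by rewrite expf_neq0 // polyXsubC_eq0.
elim: s => [|f s IH]; first by rewrite !big_nil mupNroot ?rootC ?oner_eq0.
rewrite !big_cons mupM ?prodf_seq_neq0 //; last by apply/allP=> g _; apply/implyP.
by rewrite mup_XsubCX IH; case: eqP.
Qed.

(** * Reading off the spectrum from spanning eigenspaces of bounded dimension *)

Section EigenDecomposition.
Variables (R : realFieldType) (N : nat) (A : 'M[R]_N).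
Variable F : seq (R * nat * {vspace 'cV[R]_N}).
Hypothesis space_eig : {in F, forall f, (Defs.space f <= eigsp A (value f))%VS}.
Hypothesis dim_le_mult : {in F, forall f, (\dim (Defs.space f) <= multiplicity f)%N}.
Hypothesis sum_space : (\sum_(f <- F) Defs.space f)%VS = fullv.
Hypothesis sum_mult : (\sum_(f <- F) multiplicity f)%N = N.

(** Since the spaces span, [N] is at most the sum of the dimensions, which is at most the sum of the
    multiplicities, which is [N]. A strict inequality at one [f] would break this chain. *)
Lemma dim_space_eq_mult : {in F, forall f, \dim (Defs.space f) = multiplicity f}.
Proof.
have dimF : \dim {:'cV[R]_N} = N by rewrite dimvf /dim /= muln1.
have N_le : (N <= \sum_(f <- F) \dim (Defs.space f))%N.
  by rewrite -[X in (X <= _)%N]dimF -sum_space dimv_leq_sum.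
have: (\sum_(f <- F) \dim (Defs.space f) == \sum_(f <- F) multiplicity f)%N.
  rewrite eqn_leq {2}sum_mult N_le andbT !big_seq.
  exact: leq_sum.
move=> eqsum f Ff; apply/eqP; move: eqsum.
rewrite !(big_rem f Ff) /= eqn_leq => /andP[_].
apply: contraLR => neq; rewrite -ltnNge -addSn.
apply: leq_add; first by rewrite ltn_neqAle neq dim_le_mult.
rewrite !big_seq; apply: leq_sum => g /mem_rem; exact: dim_le_mult.
Qed.

Lemma sum_dim_space : (\sum_(f <- F) \dim (Defs.space f))%N = N.
Proof.
rewrite -[RHS]sum_mult !big_seq; apply: eq_bigr; exact: dim_space_eq_mult.
Qed.

(** Directness is expressed for sums indexed by a finite type, so the positions in [F] serve as
    indices; [f0] is only the default of [nth]. *)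
Let f0 : R * nat * {vspace 'cV[R]_N} := (0, 0%N, 0%VS).
Let Fi (i : 'I_(size F)) := nth f0 F i.

Let FiF i : Fi i \in F. Proof. exact: mem_nth. Qed.

Lemma space_direct : directv (\sum_i Defs.space (Fi i)).
Proof.
apply/directvP; rewrite /= -[LHS]/(\dim (\sum_i Defs.space (Fi i))%VS).
have -> : (\sum_i Defs.space (Fi i))%VS = fullv.
  by rewrite -sum_space (big_nth f0) big_mkord.
rewrite dimvf /dim /= muln1 -[LHS]sum_dim_space (big_nth f0) big_mkord.
by [].
Qed.

(** Decompose an eigenvector for [a] along the listed spaces and apply [A - a]: the components,
    scaled by [value - a], sum to zero. By directness each of them is zero, so only components with
    value [a] survive. *)
Lemma eigsp_sum_space a :
  eigsp A a = (\sum_(f <- F | value f == a) Defs.space f)%VS.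
Proof.
rewrite (big_nth f0) big_mkord; apply/eqP; rewrite eqEsubv; apply/andP; split.
  apply/subvP=> x; rewrite mem_eigsp => /eqP Ax.
  have: x \in (\sum_i Defs.space (Fi i))%VS.
    have <- : fullv = (\sum_i Defs.space (Fi i))%VS.
      by rewrite -sum_space (big_nth f0) big_mkord.
    exact: memvf.
  case/memv_sumP=> xs xsP defx.
  have z0 : \sum_i (value (Fi i) - a) *: xs i = 0.
    rewrite -[RHS](subrr (A *m x)) [in X in _ - X]Ax defx scaler_sumr mulmx_sumr.
    rewrite -sumrB; apply: eq_bigr => i _; rewrite scalerBl.
    have /subvP/(_ _ (xsP i isT)) := space_eig (FiF i).
    by rewrite mem_eigsp => /eqP ->.
  have xs0 i : value (Fi i) != a -> xs i = 0.
    move=> neq; have /directv_sum_independent/(_ _ _ z0 i isT)/eqP := space_direct.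
    rewrite scaler_eq0 subr_eq0 (negPf neq) /= => h; apply/eqP/h => j _.
    exact/memvZ/xsP.
  rewrite defx (bigID (fun i => value (Fi i) == a)) /= [X in _ + X]big1 //.
  by rewrite addr0; apply: memv_sumr => i _; apply: xsP.
by apply/subv_sumP=> i /eqP <-; apply: space_eig; apply: FiF.
Qed.

Lemma dim_eigsp a :
  \dim (eigsp A a) = (\sum_(f <- F | value f == a) multiplicity f)%N.
Proof.
rewrite eigsp_sum_space !(big_nth f0) !big_mkord.
have : directv (\sum_(i | value (Fi i) == a) Defs.space (Fi i)).
  apply/directv_sum_independent=> us Uu u0 i Pi.
  have /directv_sum_independent := space_direct.
  (* A relation within the subfamily becomes one for the whole family after extension by zero. *)
  move/(_ (fun j => if value (Fi j) == a then us j else 0)).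
  rewrite -big_mkcond => /(_ _ u0 i isT); rewrite Pi; apply=> j _.
  by case: ifP => [/Uu //|_]; apply: mem0v.
move/directvP=> /= ->; apply: eq_bigr => i _.
exact: (dim_space_eq_mult (FiF i)).
Qed.

(** Concatenating bases of the listed spaces, each vector tagged with its value, gives an
    eigenbasis: its length is [N] by the dimension count. *)
Lemma char_poly_prod :
  char_poly A = \prod_(f <- F) ('X - (value f)%:P) ^+ multiplicity f.
Proof.
pose E := flatten [seq [seq (value f, x) | x <- vbasis (Defs.space f)] | f <- F].
rewrite (@char_poly_eigenbasis _ _ _ E) /E.
- rewrite big_flatten /= big_map !big_seq; apply: eq_bigr => f Ff.
  rewrite big_map /= big_const_seq count_predT size_tuple iter_mulr_1.
  by rewrite dim_space_eq_mult.
- rewrite size_flatten /shape -map_comp sumnE big_map -[RHS]sum_dim_space.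
  by apply: eq_bigr => f _; rewrite /= size_map size_tuple.
- rewrite -sum_space /unzip2 map_flatten -map_comp.
  elim: (F) => [|f s IH]; first by rewrite big_nil span_nil.
  rewrite /= span_cat IH big_cons -map_comp map_id_in //.
  by rewrite (span_basis (vbasisP _)).
- move=> e /flattenP[_ /mapP[f Ff ->] /mapP[x xf ->]] /=.
  apply/eqP; rewrite -mem_eigsp.
  by apply: (subvP (space_eig Ff)); apply: vbasis_mem.
Qed.

Lemma eigenvalue_as_listed_of_decomposition :
  {in F, forall f, eigenvalue_as_listed A F f}.
Proof.
move=> f Ff; split.
- exact: space_eig.
- exact: dim_space_eq_mult.
- move=> m_gt0; rewrite /passmx.leigenvalue.
  rewrite -[passmx.leigenspace _ _]/(eigsp A (value f)).
  apply: contraTneq m_gt0 => eig0; rewrite -(dim_space_eq_mult Ff) -leqNgt.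
  by have := dimvS (space_eig Ff); rewrite eig0 dimv0.
- move=> uniq_f.
  have eig_f : eigsp A (value f) = Defs.space f.
    apply/eqP; rewrite eqEsubv space_eig // andbT eigsp_sum_space.
    rewrite big_seq_cond.
    apply: (big_ind (fun U => (U <= Defs.space f)%VS)) => [|U V|g /andP[Fg /eqP vgf]].
    + exact: sub0v.
    + by rewrite subv_add => -> ->.
    (* A family [g] with the same value is either [f] itself or has multiplicity zero, and then its
       space is trivial. *)
    have [m0|m_gt0] := posnP (multiplicity g); last by rewrite (uniq_f g).
    have := dim_space_eq_mult Fg; rewrite m0 => /eqP; rewrite dimv_eq0.
    by move=> /eqP ->; exact: sub0v.
  split=> //; rewrite char_poly_prod.
  rewrite (mup_prod_XsubC F (@value R N) (@multiplicity R N)) -dim_eigsp.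
  by rewrite eig_f dim_space_eq_mult.
Qed.

Lemma spectrum_exhausted_of_decomposition : spectrum_exhausted_by A F.
Proof.
split=> //; [exact: sum_dim_space | exact: char_poly_prod | exact: eigsp_sum_space].
Qed.

End EigenDecomposition.

(** * Dimensions and splittings of the subspaces [V(I)] and [V(I; J)] *)

Section Subspaces.
Variables (R : realFieldType) (N : nat).
Implicit Types (x : 'cV[R]_N) (I J : {set 'I_N}) (U : {vspace 'cV[R]_N}).

(** Evaluates the inner products in the action of the Jacobian on [xstar], with [c] taken as [a],
    [b] or the constant 1. *)
Lemma sum_xstar I J (c : 'I_N -> R) : [disjoint I & J] ->
  \sum_k c k * xstar R I J k 0
  = #|J|%:R * \sum_(k in I) c k - #|I|%:R * \sum_(k in J) c k.
Proof.
move=> dIJ; rewrite -mulNr !mulr_sumr.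
rewrite [X in _ = X + _]big_mkcond [X in _ = _ + X]big_mkcond -big_split /=.
apply: eq_bigr => k _; rewrite mxE.
case: ifP => kI; last by case: ifP => _; rewrite ?mulr0 add0r // mulrC.
by rewrite (disjointFr dIJ kI) addr0 mulrC.
Qed.

Lemma sum_xstar_eq0 I J : [disjoint I & J] -> \sum_k xstar R I J k 0 = 0.
Proof.
move=> dIJ; under eq_bigr do rewrite -[xstar _ _ _ _ _]mul1r.
by rewrite (sum_xstar (fun=> 1)) // !sumr_const mulrC subrr.
Qed.

Lemma Vpair_sub I J U : xstar R I J \in U -> (Vpair R I J <= U)%VS.
Proof. by move=> xU; rewrite /Vpair; case: ifP; rewrite ?sub0v -?memvE. Qed.

Lemma dim_Vpair_le1 I J : (\dim (Vpair R I J) <= 1)%N.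
Proof. by rewrite /Vpair; case: ifP => _; rewrite ?dimv0 // dim_vline leq_b1. Qed.

Lemma Vsum0_sum x I : x \in Vsum0 R I -> \sum_k x k 0 = 0.
Proof.
case/mem_Vsum0=> x0 sumx; rewrite -[RHS]sumx [RHS]big_mkcond; apply: eq_bigr => k _.
by case: ifP => // /negbT/x0.
Qed.

Lemma Vsum0_set0 : Vsum0 R set0 = 0%VS :> {vspace 'cV[R]_N}.
Proof.
apply/eqP; rewrite -subv0; apply/subvP=> x /mem_Vsum0[x0 _].
by rewrite memv0; apply/eqP/colP=> i; rewrite mxE x0 ?inE.
Qed.

(** The list of families omits those of empty index sets. Here and in [Vpair_if], such an omission
    leaves the sum of spaces unchanged, because the omitted space is zero. *)
Lemma Vsum0_if I :
  (if I != set0 then Vsum0 R I else 0)%VS = Vsum0 R I.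
Proof. by case: eqVneq => // ->; rewrite Vsum0_set0. Qed.

Lemma Vpair_if I J :
  (if (I != set0) && (J != set0) then Vpair R I J else 0)%VS = Vpair R I J.
Proof. by rewrite /Vpair; case: eqP; case: eqP. Qed.

(** For a fixed [i0] in [I], the space is spanned by the differences of unit vectors [e_i - e_i0]
    with [i] in [I :\ i0]. For empty [I] both sides are 0. *)
Lemma dim_Vsum0_le I : (\dim (Vsum0 R I) <= #|I|.-1)%N.
Proof.
have [->|[i0 i0I]] := set_0Vmem I; first by rewrite Vsum0_set0 dimv0.
pose X := [seq delta_mx i 0 - delta_mx i0 0 : 'cV[R]_N | i <- enum (I :\ i0)].
have szX : size X = #|I|.-1 by rewrite size_map -cardE (cardsD1 i0 I) i0I.
rewrite -szX; apply: leq_trans (dim_span X); apply: dimvS; apply/subvP=> x.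
case/mem_Vsum0=> x0 sumx.
have -> : x = \sum_(i in I :\ i0) x i 0 *: (delta_mx i 0 - delta_mx i0 0).
  (* The zero sum makes the coefficients of [e_i0] add up to the entry of [x] at [i0]. *)
  have sumI' : \sum_(i in I :\ i0) x i 0 = - x i0 0.
    by move/eqP: sumx; rewrite (big_setD1 i0) //= addrC addr_eq0 => /eqP.
  apply/colP=> j; under eq_bigr do rewrite scalerBr.
  rewrite sumrB -scaler_suml sumI' scaleNr opprK.
  rewrite mxE summxE.
  rewrite mxE [delta_mx i0 0 j 0]mxE andbT.
  under eq_bigr do rewrite !mxE andbT.
  have [ji0|ji0] := eqVneq j i0.
    rewrite ji0 big1 ?add0r ?mulr1 // => k; rewrite !inE eq_sym => /andP[/negPf-> _].
    by rewrite mulr0.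
  rewrite mulr0 addr0; case: (boolP (j \in I)) => jI.
    rewrite (big_setD1 j) ?inE ?ji0 //= eqxx mulr1 big1 ?addr0 // => k.
    by rewrite !inE eq_sym => /and3P[/negPf-> _ _]; rewrite mulr0.
  rewrite x0 // big1 // => k; rewrite !inE => /andP[_ kI].
  by have [jk|_] := eqVneq j k; [rewrite -jk (negPf jI) in kI | rewrite mulr0].
apply: rpred_sum => i iI; apply/memvZ/memv_span/map_f.
by rewrite mem_enum.
Qed.

Lemma Vsum0_sub I J : I \subset J -> (Vsum0 R I <= Vsum0 R J)%VS.
Proof.
move=> sIJ; apply/subvP=> x /mem_Vsum0[x0 sumx]; apply/mem_Vsum0; split.
  by move=> i iJ; apply: x0; apply: contra iJ; apply: (subsetP sIJ).
rewrite -[RHS]sumx [LHS](big_setID I) /= (setIidPr sIJ) [X in _ + X]big1 ?addr0 //.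
by move=> i /setDP[_ /x0].
Qed.

Lemma Vsum0U I J : [disjoint I & J] ->
  Vsum0 R (I :|: J) = (Vpair R I J + Vsum0 R I + Vsum0 R J)%VS.
Proof.
move=> dIJ; apply/eqP; rewrite eqEsubv !subv_add !Vsum0_sub ?subsetUl ?subsetUr //.
rewrite !andbT; apply/andP; split; last first.
  apply: Vpair_sub; apply/mem_Vsum0; split=> [i|].
    by rewrite !inE negb_or mxE => /andP[/negPf-> /negPf->].
  transitivity (\sum_k 1 * xstar R I J k 0).
    rewrite [LHS]big_mkcond; apply: eq_bigr => k _; rewrite mul1r inE mxE.
    by case: (k \in I) => //=; case: (k \in J).
  by rewrite sum_xstar // !sumr_const mulrC subrr.
(* The degenerate cases come first, since the splitting below divides by both cardinalities. *)
have [->|I0] := eqVneq I set0; first by rewrite set0U addvSr.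
have [->|J0] := eqVneq J set0.
  by rewrite setU0 -addvA addvC -addvA addvSl.
apply/subvP=> x /mem_Vsum0[x0].
rewrite (eq_bigl [predU I & J]) => [|i]; last by rewrite !inE.
rewrite bigU //= => sumx.
have cI0 : #|I|%:R != 0 :> R by rewrite pnatr_eq0 cards_eq0.
have cJ0 : #|J|%:R != 0 :> R by rewrite pnatr_eq0 cards_eq0.
pose s := \sum_(i in I) x i 0.
(* The entries of [xstar] sum to [|I| |J|] over [I] and to the opposite over [J]. With this factor
   [y] has the same sums as [x] on both sets, so [x - y] restricts to a zero-sum vector on each. *)
pose y := (s / (#|I|%:R * #|J|%:R)) *: xstar R I J.
pose restr (A : {set 'I_N}) : 'cV[R]_N := \col_i (if i \in A then (x - y) i 0 else 0).
have restr0 (A : {set 'I_N}) : \sum_(i in A) (x i 0 - y i 0) = 0 -> restr A \in Vsum0 R A.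
  move=> sA; apply/mem_Vsum0; split=> [i /negPf iA|]; first by rewrite mxE iA.
  by rewrite -[RHS]sA; apply: eq_bigr => i iA; rewrite mxE iA !mxE.
have -> : x = y + restr I + restr J.
  apply/colP=> i; rewrite !mxE; case iI: (i \in I).
    by rewrite (disjointFr dIJ iI); ring.
  case iJ: (i \in J); first by ring.
  by rewrite x0 ?inE ?iI ?iJ // mulr0 !addr0.
rewrite !memv_add //.
- by rewrite /Vpair (negPf I0) (negPf J0) memvZ ?memv_line.
- apply: restr0; rewrite sumrB -/s.
  rewrite [X in _ - X](eq_bigr (fun=> s / #|I|%:R)); last first.
    by move=> i iI; rewrite !mxE iI; field; rewrite ?cI0 ?cJ0.
  by rewrite sumr_const -mulr_natr; field.
- apply: restr0; rewrite sumrB.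
  have -> : \sum_(i in J) x i 0 = - s by apply/eqP; rewrite -addr_eq0 addrC sumx.
  rewrite [X in _ - X](eq_bigr (fun=> - (s / #|J|%:R))); last first.
    by move=> i iJ; rewrite !mxE iJ (disjointFl dIJ iJ); field; rewrite ?cI0 ?cJ0.
  by rewrite sumr_const -mulr_natr; field.
Qed.

Lemma Vpm_Vsum0 (K : R -> {set 'I_N}) : [disjoint K 1 & K (-1)] ->
  Vpm K = Vsum0 R (Ipm K).
Proof. by move=> dK; rewrite /Vpm /Ipm Vsum0U. Qed.

(** Subtracting the mean of the entries leaves a zero-sum vector. *)
Lemma Vone_Vsum0_full : (Vone R N + Vsum0 R [set: 'I_N])%VS = fullv.
Proof.
apply/eqP; rewrite eqEsubv subvf /=; apply/subvP=> x _.
pose m := (\sum_i x i 0) / N%:R.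
have -> : x = m *: const_mx 1 + (x - m *: const_mx 1) by rewrite addrC subrK.
apply: memv_add; first exact/memvZ/memv_line.
apply/mem_Vsum0; split=> [i|]; first by rewrite inE.
(* For [N = 0] the mean is a division by zero, but the sum to be evaluated is empty. *)
have [N0|N0] := posnP N; first
  by rewrite big1 // => -[i lti]; exfalso; rewrite N0 in lti.
under eq_bigr do rewrite !mxE mulr1.
rewrite sumrB sumr_const cardsT card_ord -mulr_natr divfK ?pnatr_eq0 -?lt0n //.
by rewrite [X in X - _](eq_bigl predT) ?subrr // => i; rewrite inE.
Qed.

End Subspaces.

(** * Action of the Jacobian on a vector *)

(** [C i k * eta i * eta k] equals [a i * a k + b i * b k]. Full sums may replace those over
    [k != i]: the added terms [a i * a i * x i] and [b i * b i * x i] occur once with each sign, and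
    the [eps] terms leave the factor [N - 1]. *)
Lemma jacobian_mulmx (R : realFieldType) (N : nat) (eps : R)
    (xi1 xi2 eta x : 'cV[R]_N) (i : 'I_N)
    (a := fun k => xi1 k 0 * eta k 0) (b := fun k => xi2 k 0 * eta k 0) :
  (jacobian eps (coupling xi1 xi2) eta *m x) i 0
  = N%:R^-1 * (a i * \sum_k a k * x k 0 + b i * \sum_k b k * x k 0
               + 2 * eps * \sum_k x k 0
               - (a i * \sum_k a k + b i * \sum_k b k + 2 * eps * N%:R) * x i 0).
Proof.
rewrite mxE !(bigD1 (P := predT) i) //= !mxE eqxx.
have -> : \sum_(k < N | k != i) coupling xi1 xi2 i k * eta i 0 * eta k 0
    = a i * \sum_(k < N | k != i) a k + b i * \sum_(k < N | k != i) b k.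
  rewrite !mulr_sumr -big_split /=; apply: eq_bigr => k _.
  by rewrite mxE /a /b; ring.
have -> : \sum_(k < N | k != i) jacobian eps (coupling xi1 xi2) eta i k * x k 0
    = N%:R^-1 * (a i * \sum_(k < N | k != i) a k * x k 0
        + b i * \sum_(k < N | k != i) b k * x k 0
        + 2 * eps * \sum_(k < N | k != i) x k 0).
  rewrite !mulr_sumr -!big_split mulr_sumr /=; apply: eq_bigr => k ki.
  by rewrite !mxE eq_sym (negPf ki) /a /b; ring.
ring.
Qed.

Lemma eq1N1 (R : numDomainType) :
  ((1 == -1 :> R) = false) * ((-1 == 1 :> R) = false).
Proof.
have neq : (1 == -1 :> R) = false
  by rewrite -subr_eq0 opprK -[1 + 1]/(2%:R) pnatr_eq0.
by rewrite [-1 == 1]eq_sym neq.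
Qed.

Lemma sum_setU (R : nmodType) (T : finType) (I K : {set T}) (c : T -> R) :
  [disjoint I & K] ->
  \sum_(i in I :|: K) c i = \sum_(i in I) c i + \sum_(i in K) c i.
Proof.
move=> dIK; rewrite (eq_bigl [predU I & K]) => [|i]; last by rewrite !inE.
by rewrite bigU.
Qed.

Lemma disjoint_cardsU (T : finType) (I K : {set T}) :
  [disjoint I & K] -> #|I :|: K| = (#|I| + #|K|)%N.
Proof. by move=> dIK; rewrite cardsU (disjoint_setI0 dIK) cards0 subn0. Qed.

(** * The four level sets of [(a, b)] and the eigenvectors they carry *)

Section Spectrum.
Variables (R : realFieldType) (N : nat) (eps : R) (xi1 xi2 eta : 'cV[R]_N).
Hypothesis xi1_sign : sign_vector xi1.
Hypothesis xi2_sign : sign_vector xi2.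
Hypothesis eta_sign : sign_vector eta.

Local Notation Jac := (jacobian eps (coupling xi1 xi2) eta).
Local Notation J11 := (Ipm (I11s xi1 xi2 eta)).
Local Notation J12 := (Ipm (I12s xi1 xi2 eta)).
Local Notation J21 := (Ipm (I21s xi1 xi2 eta)).
Local Notation J22 := (Ipm (I22s xi1 xi2 eta)).
Local Notation J1 := (I1 xi1 xi2).
Local Notation J2 := (I2 xi1 xi2).

Let a k := xi1 k 0 * eta k 0.
Let b k := xi2 k 0 * eta k 0.

(** Indexing by all eight quantities lets one case analysis on [cellP] substitute [a i], [b i] and
    every membership at once. *)
Variant cell_spec : R -> R -> bool -> bool -> bool -> bool -> bool -> bool -> Prop :=
  | InJ11 : cell_spec 1 1 true false false false true false
  | InJ12 : cell_spec (-1) (-1) false true false false true false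
  | InJ21 : cell_spec 1 (-1) false false true false false true
  | InJ22 : cell_spec (-1) 1 false false false true false true.

Lemma cellP i : cell_spec (a i) (b i) (i \in J11) (i \in J12) (i \in J21)
  (i \in J22) (i \in J1) (i \in J2).
Proof.
rewrite /a /b !inE.
case: (xi1_sign i) => ->; case: (xi2_sign i) => ->; case: (eta_sign i) => ->;
  rewrite ?mulr1 ?mulrN1 ?opprK ?eqxx ?eq1N1 /=; constructor.
Qed.

(** In all four index families the superscript is the value of [xi1], so the halves for [1] and [-1]
    are disjoint. *)
Lemma Vpm_xi1 (K : R -> {set 'I_N}) :
  (forall s i, i \in K s -> xi1 i 0 = s) -> Vpm K = Vsum0 R (Ipm K).
Proof.
move=> xi1K; apply: Vpm_Vsum0; rewrite -setI_eq0; apply/eqP/setP=> i.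
rewrite in_setI in_set0; apply/negP=> /andP[/xi1K xi1_eq1 /xi1K/eqP].
by rewrite xi1_eq1 eq1N1.
Qed.

Lemma Vpm_I11 : Vpm (I11s xi1 xi2 eta) = Vsum0 R J11.
Proof. by apply: Vpm_xi1 => s i; rewrite !inE => /and4P[_ /eqP]. Qed.

Lemma Vpm_I12 : Vpm (I12s xi1 xi2 eta) = Vsum0 R J12.
Proof. by apply: Vpm_xi1 => s i; rewrite !inE => /and4P[_ /eqP]. Qed.

Lemma Vpm_I21 : Vpm (I21s xi1 xi2 eta) = Vsum0 R J21.
Proof. by apply: Vpm_xi1 => s i; rewrite !inE => /and4P[_ /eqP]. Qed.

Lemma Vpm_I22 : Vpm (I22s xi1 xi2 eta) = Vsum0 R J22.
Proof. by apply: Vpm_xi1 => s i; rewrite !inE => /and4P[_ /eqP]. Qed.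

Lemma J1E : J1 = J11 :|: J12.
Proof. by apply/setP=> i; rewrite in_setU; case: cellP. Qed.

Lemma J2E : J2 = J21 :|: J22.
Proof. by apply/setP=> i; rewrite in_setU; case: cellP. Qed.

Lemma J1_J2_setT : J1 :|: J2 = setT.
Proof. by apply/setP=> i; rewrite in_setU in_setT; case: cellP. Qed.

Lemma disjoint_J11_J12 : [disjoint J11 & J12].
Proof.
by rewrite -setI_eq0; apply/eqP/setP=> i; rewrite in_setI in_set0; case: cellP.
Qed.

Lemma disjoint_J21_J22 : [disjoint J21 & J22].
Proof.
by rewrite -setI_eq0; apply/eqP/setP=> i; rewrite in_setI in_set0; case: cellP.
Qed.

Lemma disjoint_J1_J2 : [disjoint J1 & J2].
Proof.
by rewrite -setI_eq0; apply/eqP/setP=> i; rewrite in_setI in_set0; case: cellP.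
Qed.

Lemma card_J1 : #|J1| = (#|J11| + #|J12|)%N.
Proof. by rewrite J1E disjoint_cardsU ?disjoint_J11_J12. Qed.

Lemma card_J2 : #|J2| = (#|J21| + #|J22|)%N.
Proof. by rewrite J2E disjoint_cardsU ?disjoint_J21_J22. Qed.

Lemma card_J1_J2 : (#|J1| + #|J2|)%N = N.
Proof.
by rewrite -disjoint_cardsU ?disjoint_J1_J2 // J1_J2_setT cardsT card_ord.
Qed.

Lemma sum_const_in (I : {set 'I_N}) (c : 'I_N -> R) (v : R) :
  {in I, forall i, c i = v} -> \sum_(i in I) c i = v * #|I|%:R.
Proof. by move=> cv; rewrite (eq_bigr _ cv) sumr_const mulr_natr. Qed.

Lemma sum_J11 :
  (\sum_(i in J11) a i = #|J11|%:R) * (\sum_(i in J11) b i = #|J11|%:R).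
Proof. by split; rewrite (sum_const_in (v := 1)) ?mul1r // => i; case: cellP. Qed.

Lemma sum_J12 :
  (\sum_(i in J12) a i = - #|J12|%:R) * (\sum_(i in J12) b i = - #|J12|%:R).
Proof. by split; rewrite (sum_const_in (v := -1)) ?mulN1r // => i; case: cellP. Qed.

Lemma sum_J21 :
  (\sum_(i in J21) a i = #|J21|%:R) * (\sum_(i in J21) b i = - #|J21|%:R).
Proof.
split; first by rewrite (sum_const_in (v := 1)) ?mul1r // => i; case: cellP.
by rewrite (sum_const_in (v := -1)) ?mulN1r // => i; case: cellP.
Qed.

Lemma sum_J22 :
  (\sum_(i in J22) a i = - #|J22|%:R) * (\sum_(i in J22) b i = #|J22|%:R).
Proof.
split; first by rewrite (sum_const_in (v := -1)) ?mulN1r // => i; case: cellP.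
by rewrite (sum_const_in (v := 1)) ?mul1r // => i; case: cellP.
Qed.

Lemma sum_J1 :
  (\sum_(i in J1) a i = #|J11|%:R - #|J12|%:R)
  * (\sum_(i in J1) b i = #|J11|%:R - #|J12|%:R).
Proof. by rewrite J1E !(sum_setU _ disjoint_J11_J12) !sum_J11 !sum_J12. Qed.

Lemma sum_J2 :
  (\sum_(i in J2) a i = #|J21|%:R - #|J22|%:R)
  * (\sum_(i in J2) b i = - #|J21|%:R + #|J22|%:R).
Proof. by rewrite J2E !(sum_setU _ disjoint_J21_J22) !sum_J21 !sum_J22. Qed.

Lemma sum_ord_J1_J2 (c : 'I_N -> R) :
  \sum_i c i = \sum_(i in J1) c i + \sum_(i in J2) c i.
Proof.
rewrite -(sum_setU _ disjoint_J1_J2) J1_J2_setT.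
by apply: eq_bigl => i; rewrite in_setT.
Qed.

(** On the constant vector the three inner products become exactly the sums subtracted in
    [jacobian_mulmx]. *)
Lemma eig_Vone : (Vone R N <= eigsp Jac 0)%VS.
Proof.
rewrite /Vone -memvE mem_eigsp; apply/eqP/colP=> i; rewrite jacobian_mulmx.
have e (c : 'I_N -> R) : \sum_k c k * (const_mx 1 : 'cV[R]_N) k 0 = \sum_k c k.
  by apply: eq_bigr => k _; rewrite mxE mulr1.
rewrite !e; under [X in 2 * eps * X]eq_bigr do rewrite mxE.
by rewrite sumr_const card_ord !mxE; ring.
Qed.

Lemma eig_Vsum0 (I : {set 'I_N}) (u v lam : R) :
  {in I, forall i, a i = u} -> {in I, forall i, b i = v} ->
  N%:R * lam = - (u * \sum_k a k + v * \sum_k b k + 2 * eps * N%:R) ->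
  (0 < N)%N ->
  (Vsum0 R I <= eigsp Jac lam)%VS.
Proof.
move=> aI bI lamE N0; apply/subvP=> x xI; rewrite mem_eigsp.
have [x0 sumx] := mem_Vsum0 _ _ xI.
(* As [x] vanishes off [I], the weight [c] may be replaced by its constant value [w] there. *)
have ortho (c : 'I_N -> R) w : {in I, forall i, c i = w} -> \sum_k c k * x k 0 = 0.
  move=> cI; transitivity (w * \sum_k x k 0); last by rewrite (Vsum0_sum xI) mulr0.
  rewrite mulr_sumr.
  apply: eq_bigr => k _; have [/cI-> //|/x0->] := boolP (k \in I).
  by rewrite !mulr0.
apply/eqP/colP=> i; rewrite jacobian_mulmx (ortho _ _ aI) (ortho _ _ bI).
rewrite (Vsum0_sum xI) mxE; have [iI|/x0->] := boolP (i \in I); last by ring.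
have NR0 : N%:R != 0 :> R by rewrite pnatr_eq0 -lt0n.
rewrite -/(a i) -/(b i) aI // bI // -[lam](mulKf NR0) lamE; ring.
Qed.

Hypothesis J1_neq0 : J1 != set0.

(** Makes [N] invertible in [R], as the eigenvalues with denominator [N] require. *)
Lemma N_gt0 : (0 < N)%N.
Proof. by rewrite -card_J1_J2 addn_gt0 card_gt0 J1_neq0. Qed.

Let NR0 : N%:R != 0 :> R. Proof. by rewrite pnatr_eq0 -lt0n N_gt0. Qed.

Let sum_a : \sum_k a k = #|J11|%:R - #|J12|%:R + (#|J21|%:R - #|J22|%:R).
Proof. by rewrite sum_ord_J1_J2 sum_J1 sum_J2. Qed.

Let sum_b : \sum_k b k = #|J11|%:R - #|J12|%:R + (- #|J21|%:R + #|J22|%:R).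
Proof. by rewrite sum_ord_J1_J2 sum_J1 sum_J2. Qed.

(** In [u * \sum_k a k + v * \sum_k b k] the contributions of [J2] cancel when [u = v], and those of
    [J1] when [u = - v]. Hence each of the four eigenvalues involves only two cardinalities. *)
Lemma eig_J11 : (Vpm (I11s xi1 xi2 eta)
  <= eigsp Jac (2 * ((- #|J11|%:R + #|J12|%:R) / N%:R - eps)))%VS.
Proof.
rewrite Vpm_I11.
apply: (eig_Vsum0 (u := 1) (v := 1)) N_gt0 => [i|i|]; try by case: cellP.
by rewrite sum_a sum_b; field.
Qed.

Lemma eig_J12 : (Vpm (I12s xi1 xi2 eta)
  <= eigsp Jac (2 * ((#|J11|%:R - #|J12|%:R) / N%:R - eps)))%VS.
Proof.
rewrite Vpm_I12.
apply: (eig_Vsum0 (u := -1) (v := -1)) N_gt0 => [i|i|]; try by case: cellP.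
by rewrite sum_a sum_b; field.
Qed.

Lemma eig_J21 : (Vpm (I21s xi1 xi2 eta)
  <= eigsp Jac (2 * ((#|J22|%:R - #|J21|%:R) / N%:R - eps)))%VS.
Proof.
rewrite Vpm_I21.
apply: (eig_Vsum0 (u := 1) (v := -1)) N_gt0 => [i|i|]; try by case: cellP.
by rewrite sum_a sum_b; field.
Qed.

Lemma eig_J22 : (Vpm (I22s xi1 xi2 eta)
  <= eigsp Jac (2 * ((- #|J22|%:R + #|J21|%:R) / N%:R - eps)))%VS.
Proof.
rewrite Vpm_I22.
apply: (eig_Vsum0 (u := -1) (v := 1)) N_gt0 => [i|i|]; try by case: cellP.
by rewrite sum_a sum_b; field.
Qed.

(** On every cell the memory terms from the inner products cancel those of the diagonal, so only the
    [eps] part acts, as [- (2 * eps)] on zero-sum vectors. *)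
Lemma eig_J1_J2 : (Vpair R J1 J2 <= eigsp Jac (- (2 * eps)))%VS.
Proof.
apply: Vpair_sub; rewrite mem_eigsp; apply/eqP/colP=> i; rewrite jacobian_mulmx.
rewrite !sum_xstar ?disjoint_J1_J2 // sum_xstar_eq0 ?disjoint_J1_J2 //.
rewrite -/(a _) -/(b _).
rewrite !sum_J1 !sum_J2 sum_a sum_b !mxE card_J1 card_J2 !natrD.
by case: cellP; field.
Qed.

(** Here [<a, x>] and [<b, x>] both equal [2 |J11| |J12|]. They cancel on [J2], where [a = - b]; on
    [J1] they turn the diagonal scalars of both cells into the same eigenvalue. *)
Lemma eig_J11_J12 : (Vpair R J11 J12 <= eigsp Jac (2 * (#|J1|%:R / N%:R - eps)))%VS.
Proof.
apply: Vpair_sub; rewrite mem_eigsp; apply/eqP/colP=> i; rewrite jacobian_mulmx.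
rewrite !sum_xstar ?disjoint_J11_J12 // sum_xstar_eq0 ?disjoint_J11_J12 //.
rewrite -/(a _) -/(b _).
rewrite !sum_J11 !sum_J12 sum_a sum_b !mxE card_J1 !natrD.
by case: cellP; field.
Qed.

(** Now [<b, x> = - <a, x>], so the cancellation takes place on [J1], where [a = b]. *)
Lemma eig_J21_J22 : (Vpair R J21 J22 <= eigsp Jac (2 * (#|J2|%:R / N%:R - eps)))%VS.
Proof.
apply: Vpair_sub; rewrite mem_eigsp; apply/eqP/colP=> i; rewrite jacobian_mulmx.
rewrite !sum_xstar ?disjoint_J21_J22 // sum_xstar_eq0 ?disjoint_J21_J22 //.
rewrite -/(a _) -/(b _).
rewrite !sum_J21 !sum_J22 sum_a sum_b !mxE card_J2 !natrD.
by case: cellP; field.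
Qed.

Lemma sum_listed_spaces :
  (Vone R N + Vpair R J1 J2
   + (Vpm (I11s xi1 xi2 eta) + Vpm (I12s xi1 xi2 eta) + Vpair R J11 J12)
   + (Vpm (I21s xi1 xi2 eta) + Vpm (I22s xi1 xi2 eta) + Vpair R J21 J22))%VS
  = fullv.
Proof.
rewrite Vpm_I11 Vpm_I12 Vpm_I21 Vpm_I22 -Vone_Vsum0_full -J1_J2_setT.
rewrite (Vsum0U _ disjoint_J1_J2) J1E (Vsum0U _ disjoint_J11_J12).
rewrite J2E (Vsum0U _ disjoint_J21_J22).
by rewrite (addvC _ (Vpair R J11 J12)) (addvC _ (Vpair R J21 J22)) !addvA.
Qed.

End Spectrum.

(** * Conditional list entries and assembly of the spectrum *)

Lemma big_if_seq1 (T I : Type) (op : T -> T -> T) (idx : T) (c : bool) (f : I)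
    (G : I -> T) : right_id idx op ->
  \big[op/idx]_(g <- if c then [:: f] else [::]) G g = if c then G f else idx.
Proof. by move=> opx; case: c; rewrite ?big_cons big_nil. Qed.

Lemma all_if_seq1 (T : Type) (P : pred T) (c : bool) (f : T) :
  all P (if c then [:: f] else [::]) = (c ==> P f).
Proof. by case: c; rewrite //= andbT. Qed.

Lemma mem_if_seq1 (T : eqType) (c : bool) (f : T) :
  c -> f \in (if c then [:: f] else [::]).
Proof. by move->; rewrite mem_seq1. Qed.

Theorem lemma2p1 (R : realFieldType) (N : nat) (eps : R)
    (xi1 xi2 eta : 'cV[R]_N)
    (eps_gt0 : 0 < eps)
    (xi1_sign : sign_vector xi1) (xi2_sign : sign_vector xi2)
    (xi1_neq : xi1 <> xi2 /\ xi1 <> - xi2)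
    (eta_sign : sign_vector eta)
    (eta_neq : [/\ eta <> xi1, eta <> - xi1, eta <> xi2 & eta <> - xi2]) :
  let J := jacobian eps (coupling xi1 xi2) eta in
  let J1 := I1 xi1 xi2 in
  let J2 := I2 xi1 xi2 in
  let K11 := I11s xi1 xi2 eta in
  let K12 := I12s xi1 xi2 eta in
  let K21 := I21s xi1 xi2 eta in
  let K22 := I22s xi1 xi2 eta in
  let J11 := Ipm K11 in
  let J12 := Ipm K12 in
  let J21 := Ipm K21 in
  let J22 := Ipm K22 in
  let f1 := (0, 1%N, Vone R N) in
  let f2 := (- (2 * eps), 1%N, Vpair R J1 J2) in
  let f3 := (2 * ((- #|J11|%:R + #|J12|%:R) / N%:R - eps), #|J11|.-1,
             Vpm K11) in
  let f4 := (2 * ((#|J11|%:R - #|J12|%:R) / N%:R - eps), #|J12|.-1,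
             Vpm K12) in
  let f5 := (2 * (#|J1|%:R / N%:R - eps), 1%N, Vpair R J11 J12) in
  let f6 := (2 * ((#|J22|%:R - #|J21|%:R) / N%:R - eps), #|J21|.-1,
             Vpm K21) in
  let f7 := (2 * ((- #|J22|%:R + #|J21|%:R) / N%:R - eps), #|J22|.-1,
             Vpm K22) in
  let f8 := (2 * (#|J2|%:R / N%:R - eps), 1%N, Vpair R J21 J22) in
  let F := [:: f1; f2]
    ++ (if J11 != set0 then [:: f3] else [::])
    ++ (if J12 != set0 then [:: f4] else [::])
    ++ (if (J11 != set0) && (J12 != set0) then [:: f5] else [::])
    ++ (if J21 != set0 then [:: f6] else [::])
    ++ (if J22 != set0 then [:: f7] else [::])
    ++ (if (J21 != set0) && (J22 != set0) then [:: f8] else [::]) in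
  eigenvalue_as_listed J F f1 /\
  eigenvalue_as_listed J F f2 /\
  (J11 != set0 -> eigenvalue_as_listed J F f3) /\
  (J12 != set0 -> eigenvalue_as_listed J F f4) /\
  (J11 != set0 -> J12 != set0 -> eigenvalue_as_listed J F f5) /\
  (J21 != set0 -> eigenvalue_as_listed J F f6) /\
  (J22 != set0 -> eigenvalue_as_listed J F f7) /\
  (J21 != set0 -> J22 != set0 -> eigenvalue_as_listed J F f8) /\
  spectrum_exhausted_by J F.
Proof.
move=> J J1 J2 K11 K12 K21 K22 J11 J12 J21 J22 f1 f2 f3 f4 f5 f6 f7 f8 F.
have [xi12 xi1N2] := xi1_neq.
have J1_neq0 : J1 != set0.
  apply/negP=> /eqP/setP J10; apply: xi1N2; apply/colP=> i.
  have := J10 i; rewrite !inE mxE.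
  by case: (xi1_sign i) (xi2_sign i) => -> [] ->; rewrite ?eqxx ?opprK.
have J2_neq0 : J2 != set0.
  apply/negP=> /eqP/setP J20; apply: xi12; apply/colP=> i.
  by have := J20 i; rewrite !inE => /negbFE/eqP.
have Vpm0 := (Vpm_I11, Vpm_I12, Vpm_I21, Vpm_I22).
have eigF : {in F, forall f, (Defs.space f <= eigsp J (value f))%VS}.
  apply/allP; rewrite /F !all_cat !all_if_seq1 /= /value /Defs.space /=.
  rewrite eig_Vone eig_J1_J2 // eig_J11 // eig_J12 // eig_J11_J12 // eig_J21 //.
  by rewrite eig_J22 // eig_J21_J22 // !implybT.
have dimF : {in F, forall f, (\dim (Defs.space f) <= multiplicity f)%N}.
  apply/allP; rewrite /F !all_cat !all_if_seq1 /= /multiplicity /Defs.space /=.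
  rewrite dim_vline leq_b1 !dim_Vpair_le1 !Vpm0.
  by rewrite !dim_Vsum0_le !implybT.
(* Omitted families are reinstated as zero spaces, which turns the sum over [F] into the
   unconditional one. *)
have sumF : (\sum_(f <- F) Defs.space f)%VS = fullv.
  rewrite -(sum_listed_spaces xi1_sign xi2_sign eta_sign).
  rewrite /F !big_cat !big_cons big_nil /= !big_if_seq1; try exact: addv0.
  by rewrite /Defs.space /= !Vpm0 !Vsum0_if !Vpair_if addv0 !addvA.
(* If both cells of [J1] are nonempty they contribute [(|J11| - 1) + (|J12| - 1) + 1]; if only one
   is, its cardinality minus 1. Either way this is [|J1| - 1], and likewise for [J2]; [f1] and [f2]
   supply the missing 2. Nonemptiness of [J1] and [J2] excludes a truncated predecessor. *)
have multF : (\sum_(f <- F) multiplicity f)%N = N.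
  rewrite /F !big_cat !big_cons big_nil /= !big_if_seq1; try exact: addn0.
  rewrite /multiplicity /= -!card_gt0.
  have := card_J1 xi1_sign xi2_sign eta_sign.
  have := card_J2 xi1_sign xi2_sign eta_sign.
  have := card_J1_J2 xi1_sign xi2_sign eta_sign.
  move: J1_neq0 J2_neq0; rewrite -!card_gt0.
  rewrite -/J1 -/J2 -/J11 -/J12 -/J21 -/J22.
  by case: #|J11| #|J12| #|J21| #|J22| => [|?] [|?] [|?] [|?] /=; lia.
have listed := eigenvalue_as_listed_of_decomposition eigF dimF sumF multF.
split; first by apply: listed; rewrite mem_head.
split; first by apply: listed; rewrite !inE eqxx orbT.
split; first by move=> n11; apply: listed; rewrite !mem_cat mem_if_seq1 ?orbT.
split; first by move=> n12; apply: listed; rewrite !mem_cat mem_if_seq1 ?orbT.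
split; first by move=> n11 n12; apply: listed; rewrite !mem_cat mem_if_seq1 ?n11 ?orbT.
split; first by move=> n21; apply: listed; rewrite !mem_cat mem_if_seq1 ?orbT.
split; first by move=> n22; apply: listed; rewrite !mem_cat mem_if_seq1 ?orbT.
split; first by move=> n21 n22; apply: listed; rewrite !mem_cat mem_if_seq1 ?n21 ?orbT.
exact: spectrum_exhausted_of_decomposition.
Qed.
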